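(* For each integer $m$ with $2\le m\le 13$, the $m$-bipartite Ramsey number $BR_m(K_{2,2},K_{4,4})$ satisfies: $BR_m(K_{2,2},K_{4,4})$ does not exist if $m\in\{2,3,4\}$; $BR_5(K_{2,2},K_{4,4})=26$; $BR_m(K_{2,2},K_{4,4})=22$ if $m\in\{6,7\}$; $BR_8(K_{2,2},K_{4,4})=16$; and $BR_m(K_{2,2},K_{4,4})=14$ if $m\in\{9,10,11,12,13\}$.
   Context: For bipartite graphs $H_1,H_2$ and a positive integer $m$, the $m$-bipartite Ramsey number $BR_m(H_1,H_2)$ is the least positive integer $n$ such that for every subgraph $G$ of the complete bipartite graph $K_{m,n}$ (with parts of sizes $m$ and $n$), either $G$ contains a subgraph isomorphic to $H_1$ or the bipartite complement $\overline{G}=K_{m,n}-E(G)$ contains a subgraph isomorphic to $H_2$. Equivalently, every red/blue coloring of the edges of $K_{m,n}$ has a red copy of $H_1$ or a blue copy of $H_2$. ''Does not exist'' means no such $n$ exists. *)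

(* Defs.v *)
From mathcomp Require Import all_boot.

Set Implicit Arguments.
Unset Strict Implicit.
Unset Printing Implicit Defensive.

Record sgraph (V : finType) := SGraph {
  edge :> rel V;
  edge_sym : symmetric edge;
  edge_irrefl : irreflexive edge }.

(* Spanning subgraphs only: a subgraph is determined by its edge set. *)
Definition subgraph (V : finType) (G K : sgraph V) : Prop := subrel G K.

Definition contains_copy (V W : finType) (G : sgraph V) (H : sgraph W) : Prop :=
  exists2 f : W -> V, injective f & forall x y, H x y -> G (f x) (f y).

Section Diff.
Variables (V : finType) (K G : sgraph V).

Definition gdiff_rel : rel V := fun x y => K x y && ~~ G x y.

Lemma gdiff_sym : symmetric gdiff_rel.
Proof. by move=> x y; rewrite /gdiff_rel edge_sym (edge_sym G). Qed.

Lemma gdiff_irrefl : irreflexive gdiff_rel.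
Proof. by move=> x; rewrite /gdiff_rel edge_irrefl. Qed.

(* K - E(G) *)
Definition gdiff : sgraph V := SGraph gdiff_sym gdiff_irrefl.
End Diff.

Section CompleteBipartite.
Variables m n : nat.

Definition Kbip_rel : rel ('I_m + 'I_n)%type := fun x y =>
  match x, y with
  | inl _, inr _ | inr _, inl _ => true
  | _, _ => false
  end.

Lemma Kbip_sym : symmetric Kbip_rel.
Proof. by case=> ? []. Qed.

Lemma Kbip_irrefl : irreflexive Kbip_rel.
Proof. by case. Qed.

Definition Kbip : sgraph ('I_m + 'I_n)%type := SGraph Kbip_sym Kbip_irrefl.
End CompleteBipartite.

Section BipartiteRamsey.
Variables (V1 V2 : finType) (m : nat) (H1 : sgraph V1) (H2 : sgraph V2).

Definition BR_arrows (n : nat) : Prop :=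
  forall G : sgraph ('I_m + 'I_n)%type, subgraph G (Kbip m n) ->
    contains_copy G H1 \/ contains_copy (gdiff (Kbip m n) G) H2.

(* BR_m(H1, H2) = n.  The number need not exist, so it is given as a relation;
   the definition makes sense for all H1 and H2, bipartite or not. *)
Definition is_BR (n : nat) : Prop :=
  [/\ 0 < n, BR_arrows n & forall k, 0 < k -> BR_arrows k -> n <= k].
End BipartiteRamsey.

(* Main.v *)
Require Import Defs.
From mathcomp Require Import all_boot.

(** Read a colouring of K_(m,n) as n columns, each the set of rows joined to it in
    red.  Red K_(2,2)-freeness says that two rows share at most one column, blue
    K_(4,4)-freeness that any four rows together miss at most three columns.

    For m = 5, 6, 7 a weighted double count bounds n: a column with k red entries
    contributes 'C(k, 2) pairs of rows, each pair occurring at most once, and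
    'C(m - k, 4) missed 4-sets of rows, each occurring at most three times.

    This is too weak for 9 rows and 14 columns or 8 rows and 16 columns, which are
    excluded by exhaustive search, adding one row at a time.  Columns that agree on
    the rows added so far are interchangeable, so a partial colouring is the list
    of sizes of these classes of columns, and a row still to be added is the vector
    of its counts in the classes.  The candidate vectors are kept in a list, and
    the next row is one whose vector comes earliest, so the later rows lie in the
    suffix starting there; this breaks the symmetry between rows.

    The extremal colourings are explicit, and a single red row settles m <= 4. *)

Set Implicit Arguments.
Unset Strict Implicit.
Unset Printing Implicit Defensive.

(** * Exhaustive search, row by row *)

(* The parts of a class of size c cut by a row meeting it t times; empty parts are dropped. *)
Definition piece (T : Type) (c t : nat) (x y : T) : seq T :=
  (if 0 < t then [:: x] else [::]) ++ (if t < c then [:: y] else [::]).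

Definition subdivide (T : Type) (cs r : seq nat) (xs : seq (T * T)) : seq T :=
  flatten [seq piece p.1.1 p.1.2 p.2.1 p.2.2 | p <- zip (zip cs r) xs].

(* The ways in which a row with counts v can be distributed over the parts cut by
   a row with counts r, sharing at most b columns with that row. *)
Fixpoint expand (b : bool) (cs r v : seq nat) : seq (seq nat) :=
  match cs, r, v with
  | c :: cs', t :: r', x :: v' =>
    (if [&& b, 0 < t, 0 < x & x.-1 <= c - t]
     then [seq piece c t 1 x.-1 ++ w | w <- expand false cs' r' v'] else [::]) ++
    (if x <= c - t
     then [seq piece c t 0 x ++ w | w <- expand b cs' r' v'] else [::])
  | _, _, _ => [:: [::]]
  end.

Fixpoint pairs (T : Type) (s : seq T) : seq (T * T) :=
  if s is x :: s' then [seq (x, y) | y <- s'] ++ pairs s' else [::].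

Definition meet (u v : seq bool) : seq bool := [seq p.1 && p.2 | p <- zip u v].

(* The masks m mark classes missed by three given rows; the row v must leave at
   most three of their columns uncovered. *)
Definition thin (cs : seq nat) (ms : seq (seq bool)) (v : seq nat) : bool :=
  let w := [seq p.1 - p.2 | p <- zip cs v] in
  all (fun m => sumn (mask m w) <= 3) ms.

(* rows lists, for each row added so far, the classes that it misses.  The suffix s
   includes r itself, since distinct rows may have equal counts. *)
Fixpoint refuted (k : nat) (cs : seq nat) (rows : seq (seq bool))
    (cands : seq (seq nat)) : bool :=
  if k is k'.+1 then
    (fix loop s := if s is r :: s' then
       loop s' &&
       let cs' := subdivide cs r [seq (p.2, p.1 - p.2) | p <- zip cs r] in
       let new := subdivide cs r [seq (false, true) | _ <- cs] in
       let old := [seq subdivide cs r [seq (b, b) | b <- row] | row <- rows] in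
       let ms := [seq meet new (meet p.1 p.2) | p <- pairs old] in
       refuted k' cs' (new :: old)
         [seq v <- flatten [seq expand true cs r x | x <- s] | thin cs' ms v]
     else true) cands
  else false.

Lemma pairs_map (T U : Type) (f : T -> U) s :
  pairs (map f s) = [seq (f p.1, f p.2) | p <- pairs s].
Proof. by elim: s => //= x s ->; rewrite map_cat -!map_comp. Qed.

Lemma mem_pairs (T : eqType) (s : seq T) p :
  uniq s -> p \in pairs s -> [/\ p.1 \in s, p.2 \in s & p.1 != p.2].
Proof.
elim: s => //= x s IH /andP[xs us]; rewrite mem_cat => /orP[/mapP[y ys ->]|/(IH us)[p1 p2 ne]].
  by rewrite /= !inE eqxx ys orbT; split=> //; apply: contraNneq xs => ->.
by rewrite !inE p1 p2 !orbT.
Qed.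

(** * Soundness of the search *)

Section Soundness.
Variables (I : eqType) (J : Type) (M : I -> J -> bool).

Definition split_by (A : pred J) (Cs : seq (seq J)) : seq (seq J) :=
  flatten [seq piece (size C) (count A C) (filter A C) (filter (predC A) C) | C <- Cs].

Definition class_count (P : pred J) (Cs : seq (seq J)) : nat := sumn [seq count P C | C <- Cs].

Lemma map_piece (T U : Type) (f : T -> U) c t x y :
  map f (piece c t x y) = piece c t (f x) (f y).
Proof. by rewrite /piece; case: ifP; case: ifP. Qed.

Lemma map_split_by (T : Type) (f : seq J -> T) (A : pred J) Cs :
  map f (split_by A Cs) =
  flatten [seq piece (size C) (count A C) (f (filter A C)) (f (filter (predC A) C)) | C <- Cs].
Proof. by rewrite /split_by; elim: Cs => //= C Cs <-; rewrite map_cat map_piece. Qed.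

Lemma count_filterC (P A : pred J) C :
  count P (filter A C) + count P (filter (predC A) C) = count P C.
Proof.
by rewrite -!size_filter -!filter_predI; elim: C => //= j C IH; case: (A j); case: (P j);
  rewrite /= ?addnS ?addSn ?IH.
Qed.

Lemma sumn_piece c t x y :
  (t = 0 -> x = 0) -> (c <= t -> y = 0) -> sumn (piece c t x y) = x + y.
Proof.
rewrite /piece sumn_cat -[c <= t]negbK -ltnNge lt0n => x0 y0; congr (_ + _).
  by case: eqP => [/x0 -> |] //=; rewrite addn0.
by case: ifP => [|/negbT/y0 ->] //=; rewrite addn0.
Qed.

Lemma class_count_split_by (P A : pred J) Cs : class_count P (split_by A Cs) = class_count P Cs.
Proof.
rewrite /class_count map_split_by; elim: Cs => //= C Cs IH; rewrite sumn_cat IH; congr (_ + _).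
rewrite sumn_piece; first exact: count_filterC.
- by move=> A0; have := count_size P (filter A C); rewrite size_filter A0 leqn0 => /eqP.
- move=> le; have := count_size P (filter (predC A) C); rewrite size_filter.
  move: le; rewrite -(count_predC A C) -[leqRHS]addn0 leq_add2l leqn0 => /eqP ->.
  by rewrite leqn0 => /eqP.
Qed.

(** The flag [b] is an allowance of one shared column: the class containing that column uses it up,
    and later classes may share none. *)
Lemma expandP (b : bool) (A B : pred J) Cs : class_count (predI A B) Cs <= b ->
  map (count B) (split_by A Cs) \in
    expand b (map size Cs) (map (count A) Cs) (map (count B) Cs).
Proof.
rewrite map_split_by /class_count; elim: Cs b => [|C Cs IH] b //= le1.
rewrite mem_cat !count_filter.
have AB : count (predI B A) C + count (predI B (predC A)) C = count B C.
  by rewrite -!count_filter count_filterC.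
have AC : count (predI B (predC A)) C <= size C - count A C.
  rewrite -(count_predC A C) addKn; apply: sub_count => j /=; by case/andP.
have BA : count (predI B A) C = count (predI A B) C by apply: eq_count => j /=; rewrite andbC.
have AA : count (predI A B) C <= count A C by apply: sub_count => j /= /andP[].
case E : (count (predI A B) C) => [|t]; last first.
  have [b1 t0 s0] : [/\ b : bool, t = 0 & sumn [seq count (predI A B) C | C <- Cs] <= false].
    by move: le1; rewrite E; case: (b) => //=; case: t {E} => //=; rewrite addSn ltnS leqn0 => /eqP ->.
  apply/orP; left; rewrite E t0 in AA; rewrite b1 -AB BA E t0 add1n AA /= AC.
  by apply: map_f; apply: IH.
apply/orP; right; rewrite -AB BA E add0n AC; apply: map_f; apply: IH.
exact: leq_trans (leq_addl _ _) le1.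
Qed.

(** A [false] mark claims nothing: soundness needs only that marked classes are really missed. *)
Definition avoids (v : seq bool) (P : pred J) (Cs : seq (seq J)) : bool :=
  all2 (fun b C => b ==> all (predC P) C) v Cs.

Lemma avoids_meet u v P Q Cs :
  avoids u P Cs -> avoids v Q Cs -> avoids (meet u v) (predU P Q) Cs.
Proof.
rewrite /avoids /meet; elim: Cs u v => [|C Cs IH] [|x u] [|y v] //=.
case/andP=> xP uP /andP[yQ vQ]; rewrite IH // andbT.
apply/implyP => /andP[hx hy]; move: xP yQ; rewrite hx hy /= => xP yQ.
rewrite (eq_all (_ : _ =1 predI (predC P) (predC Q))) ?all_predI ?xP // => j /=.
exact: negb_or.
Qed.

Lemma all2_cat (T U : Type) (r : T -> U -> bool) s1 s2 t1 t2 :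
  all2 r s1 t1 -> all2 r s2 t2 -> all2 r (s1 ++ s2) (t1 ++ t2).
Proof. by elim: s1 t1 => [|x s1 IH] [|y t1] //= /andP[-> h1] h2; apply: IH. Qed.

Lemma all2_piece (T U : Type) (r : T -> U -> bool) c t x y x' y' :
  r x x' -> r y y' -> all2 r (piece c t x y) (piece c t x' y').
Proof. by move=> xx yy; rewrite /piece; case: ifP; case: ifP; rewrite /= ?xx ?yy. Qed.

Lemma avoids_old v P A Cs : avoids v P Cs ->
  avoids (subdivide (map size Cs) (map (count A) Cs) [seq (b, b) | b <- v]) P (split_by A Cs).
Proof.
rewrite /avoids /subdivide /split_by; elim: Cs v => [|C Cs IH] [|x v] //= /andP[xP vP].
apply: all2_cat (IH _ vP); apply: all2_piece => /=; apply/implyP => hx;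
  rewrite hx /= in xP; by rewrite all_filter; apply: sub_all xP => j /= ->; rewrite implybT.
Qed.

Lemma avoids_new A Cs :
  avoids (subdivide (map size Cs) (map (count A) Cs) [seq (false, true) | _ <- map size Cs])
    A (split_by A Cs).
Proof.
rewrite /avoids /subdivide /split_by; elim: Cs => [|C Cs IH] //=.
apply: all2_cat IH; apply: all2_piece => //=.
exact: filter_all.
Qed.

(** In a marked class [P] holds nowhere, so columns uncovered by [Q] are missed by both; unmarked
    classes only enlarge the right-hand side. *)
Lemma avoids_class_count m P Q Cs : avoids m P Cs ->
  sumn (mask m [seq p.1 - p.2 | p <- zip (map size Cs) (map (count Q) Cs)]) <=
  class_count (predC (predU P Q)) Cs.
Proof.
rewrite /avoids /class_count; elim: Cs m => [|C Cs IH] [|b m] //= /andP[bP mP].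
case: b bP => /= bP; last by apply: leq_trans (IH _ mP) (leq_addl _ _).
apply: leq_add (IH _ mP); rewrite -(count_predC Q C) addKn.
rewrite -!size_filter; have /all_filterP {1}<- := bP.
rewrite -filter_predI; apply: eq_leq; congr size; apply: eq_filter => j /=.
by rewrite negb_or andbC.
Qed.

Variables (cols : seq J).
Hypothesis meet1 : forall i i', i != i' -> count (predI (M i) (M i')) cols <= 1.
Hypothesis cover4 : forall s, uniq s -> size s = 4 ->
  count (fun j => all (fun i => ~~ M i j) s) cols <= 3.

(** [As] are the rows already added, [Bs] those to come. The inner induction discards candidates
    matching no row of [Bs]; at the first match that row moves to [As] and the outer induction
    applies. *)
Lemma refuted_sound k (Cs : seq (seq J)) (As Bs : seq I) (row : I -> seq bool) cands :
    (forall P, class_count P Cs = count P cols) ->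
    {in As, forall i, avoids (row i) (M i) Cs} ->
    uniq (As ++ Bs) -> size Bs = k ->
    {in Bs, forall i, map (count (M i)) Cs \in cands} ->
  ~~ refuted k (map size Cs) (map row As) cands.
Proof.
elim: k Cs As Bs row cands => [|k IH] Cs As Bs row cands covC rowP uniqAB szB candP //.
rewrite [refuted _ _ _ _]/=; elim: cands candP => [|r cands IHc] candP.
  by case: Bs szB candP {uniqAB} => // i Bs _ /(_ i); rewrite inE eqxx => /(_ isT).
rewrite negb_and; have [/hasP[i iB /eqP ri]|noi] := boolP (has (fun i => map (count (M i)) Cs == r) Bs); last first.
  apply/orP; left; apply: IHc => i iB; have := candP i iB; rewrite inE => /orP[ri|//].
  by case/hasP: noi; exists i.
apply/orP; right; rewrite /= -ri.
have iAs : i \notin As.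
  by move: uniqAB; rewrite cat_uniq => /and3P[_ /hasPn/(_ _ iB)].
have uniqB : uniq Bs by move: uniqAB; rewrite cat_uniq => /and3P[].
set cs' := subdivide _ _ _; set new := subdivide _ _ _; set ms := map _ (pairs _).
have csE : cs' = map size (split_by (M i) Cs).
  rewrite map_split_by /cs' /subdivide; elim: (Cs) => //= C Cs' ->.
  by rewrite !size_filter -(count_predC (M i) C) addKn.
pose old i' := subdivide (map size Cs) (map (count (M i)) Cs) [seq (b, b) | b <- row i'].
pose row' i' := if i' == i then new else old i'.
have oldE : map row' As = map old As.
  by apply/eq_in_map => i' i'A; rewrite /row'; case: eqP i'A iAs => // -> ->.
have -> : new :: [seq subdivide (map size Cs) (map (count (M i)) Cs) [seq (b, b) | b <- v]
                 | v <- map row As] = map row' (i :: As).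
  by rewrite /= [row' i]/row' eqxx oldE -map_comp.
have rowP' : {in i :: As, forall i', avoids (row' i') (M i') (split_by (M i) Cs)}.
  move=> i'; rewrite inE /row'; case: eqP => [-> _|_ /= i'A]; first exact: avoids_new.
  exact: avoids_old (rowP _ i'A).
rewrite csE; apply: (IH _ _ (rem i Bs)) => //.
- by move=> P; rewrite class_count_split_by.
- rewrite cat_cons -cat1s uniq_catCA -(perm_uniq (perm_cat (perm_refl As) (perm_to_rem iB))) in uniqAB *.
  exact: uniqAB.
- by rewrite size_rem // szB.
move=> i' i'B; rewrite mem_rem_uniq // inE in i'B; case/andP: i'B => ne i'B.
rewrite mem_filter; apply/andP; split; last first.
  apply/(@flattenP _ [seq expand true (map size Cs) (map (count (M i)) Cs) x
    | x <- map (count (M i)) Cs :: cands]).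
  exists (expand true (map size Cs) (map (count (M i)) Cs) (map (count (M i')) Cs)).
    by apply: map_f; rewrite ri; apply: candP.
  by apply: expandP; rewrite covC meet1 // eq_sym.
apply/allP => m /mapP[p]; rewrite -map_comp pairs_map => /mapP[[a b] ab -> ->] /=.
have uniqA : uniq As by move: uniqAB; rewrite cat_uniq => /and3P[].
have [/= aA bA neab] := mem_pairs uniqA ab.
have i'A : i' \notin As.
  by move: uniqAB; rewrite cat_uniq => /and3P[_ /hasPn/(_ _ i'B)].
have avo x : x \in As -> avoids (old x) (M x) (split_by (M i) Cs).
  by move=> xA; apply: avoids_old (rowP _ xA).
(* Columns in classes marked for [i], [a] and [b] and left uncovered by [i'] are missed by four
   distinct rows. *)
apply: leq_trans (avoids_class_count _ (avoids_meet (avoids_new _ _) (avoids_meet (avo _ aA) (avo _ bA)))) _.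
rewrite class_count_split_by covC; apply: leq_trans (cover4 (s := [:: i; a; b; i']) _ _) => //.
  by apply/eq_leq/eq_count => j /=; rewrite !negb_or andbT -!andbA.
have neq x y : x \in As -> y \notin As -> x != y by move=> xA; apply: contraNneq => <-.
by rewrite /= !inE !negb_or neab !(eq_sym i) ne (neq a i) // (neq b i) // (neq a i') // (neq b i').
Qed.
End Soundness.

Definition common (m n : nat) (P : 'I_m -> 'I_n -> bool) (S : {set 'I_m}) : {set 'I_n} :=
  [set j | [forall i in S, P i j]].

Definition block (m n d : nat) (P : 'I_m -> 'I_n -> bool) : bool :=
  [exists S : {set 'I_m}, (#|S| == d) && (d <= #|common P S|)].

Lemma blockI (m n d : nat) (P : 'I_m -> 'I_n -> bool) (a : 'I_d -> 'I_m) (b : 'I_d -> 'I_n) :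
  injective a -> injective b -> (forall x y, P (a x) (b y)) -> block d P.
Proof.
move=> injA injB abP; apply/existsP; exists (a @: 'I_d).
rewrite card_imset // card_ord eqxx /= -{1}[d]card_ord -(card_imset _ injB).
apply/subset_leq_card/subsetP => _ /imsetP[y _ ->]; rewrite inE.
by apply/forall_inP => _ /imsetP[x _ ->].
Qed.

Lemma block_copy (m n d : nat) (G : sgraph ('I_m + 'I_n)%type) :
  block d (fun i j => G (inl i) (inr j)) -> contains_copy G (Kbip d d).
Proof.
case/existsP => S /andP[/eqP Sd leT]; set T := common _ S in leT.
have edgeST i j : i \in S -> j \in T -> G (inl i) (inr j).
  by move=> iS; rewrite inE => /forall_inP/(_ i iS).
pose a (x : 'I_d) := enum_val (cast_ord (esym Sd) x).
pose b (y : 'I_d) := enum_val (widen_ord leT y).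
have aS x : a x \in S by apply: enum_valP.
have bT y : b y \in T by apply: enum_valP.
exists (fun v => match v with inl x => inl (a x) | inr y => inr (b y) end).
  move=> [x|y] [x'|y'] // [].
    by move/enum_val_inj/cast_ord_inj => ->.
  by move/enum_val_inj/(congr1 val) => /= eq; congr inr; apply: val_inj.
by move=> [x|y] [x'|y'] // _; [|rewrite edge_sym]; apply: edgeST.
Qed.

(** The copy may lie in either orientation: the image of one vertex fixes the part containing every
    other image. *)
Lemma copy_block (m n d : nat) (G : sgraph ('I_m + 'I_n)%type) :
  0 < d -> subgraph G (Kbip m n) -> contains_copy G (Kbip d d) ->
  block d (fun i j => G (inl i) (inr j)).
Proof.
case: d => // d _ GK [f injf edgef].
have E x y : G (f (inl x)) (f (inr y)) by exact: edgef.
have K x y : Kbip m n (f (inl x)) (f (inr y)) by apply: GK.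
case f0 : (f (inl ord0)) => [i0|j0].
- have fr y : {j | f (inr y) = inr j}.
    by case fy: (f (inr y)) (K ord0 y) => [i|j]; rewrite f0 //; exists j.
  have fl x : {i | f (inl x) = inl i}.
    have [j fj] := fr ord0.
    by case fx: (f (inl x)) (K x ord0) => [i|j']; rewrite fj //; exists i.
  apply: (blockI (a := fun x => sval (fl x)) (b := fun y => sval (fr y))).
  + by move=> x x' eq; have := svalP (fl x); rewrite eq -(svalP (fl x')) => /injf[].
  + by move=> y y' eq; have := svalP (fr y); rewrite eq -(svalP (fr y')) => /injf[].
  by move=> x y; rewrite -(svalP (fl x)) -(svalP (fr y)).
- have fr y : {i | f (inr y) = inl i}.
    by case fy: (f (inr y)) (K ord0 y) => [i|j]; rewrite f0 //; exists i.
  have fl x : {j | f (inl x) = inr j}.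
    have [j fj] := fr ord0.
    by case fx: (f (inl x)) (K x ord0) => [i|j']; rewrite fj //; exists j'.
  apply: (blockI (a := fun x => sval (fr x)) (b := fun y => sval (fl y))).
  + by move=> y y' eq; have := svalP (fr y); rewrite eq -(svalP (fr y')) => /injf[].
  + by move=> x x' eq; have := svalP (fl x); rewrite eq -(svalP (fl x')) => /injf[].
  by move=> x y; rewrite -(svalP (fl y)) -(svalP (fr x)) edge_sym.
Qed.

Lemma arrowsI (m n : nat) :
  (forall M : 'I_m -> 'I_n -> bool, block 2 M || block 4 (fun i j => ~~ M i j)) ->
  BR_arrows m (Kbip 2 2) (Kbip 4 4) n.
Proof.
move=> blockM G _; have /orP[b2|b4] := blockM (fun i j => G (inl i) (inr j)).
  by left; apply: block_copy.
by right; apply: block_copy.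
Qed.

Section Colouring.
Variables (m n : nat) (M : 'I_m -> 'I_n -> bool).

Definition red_rel : rel ('I_m + 'I_n)%type := fun u v =>
  match u, v with
  | inl i, inr j | inr j, inl i => M i j
  | _, _ => false
  end.

Lemma red_sym : symmetric red_rel.
Proof. by case=> ? []. Qed.

Lemma red_irrefl : irreflexive red_rel.
Proof. by case. Qed.

Lemma not_arrowsI : ~~ block 2 M -> ~~ block 4 (fun i j => ~~ M i j) ->
  ~ BR_arrows m (Kbip 2 2) (Kbip 4 4) n.
Proof.
move=> no2 no4 /(_ (SGraph red_sym red_irrefl)) [].
- by move=> [i|j] [i'|j'].
- by move/copy_block => /(_ isT) H; case/negP: no2; apply: H => -[i|j] [i'|j'].
by move/copy_block => /(_ isT) H; case/negP: no4; apply: H => -[i|j] [i'|j'].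
Qed.
End Colouring.

(** * Double counting *)

Lemma sum_bin_common (m n d : nat) (P : 'I_m -> 'I_n -> bool) :
  \sum_j 'C(#|[set i | P i j]|, d) = \sum_(S : {set 'I_m} | #|S| == d) #|common P S|.
Proof.
under eq_bigr => j _ do rewrite -cards_draws -sum1_card.
under [RHS]eq_bigr => S _ do rewrite -sum1_card.
rewrite (exchange_big_dep (fun S : {set 'I_m} => #|S| == d)) /=.
  apply: eq_bigr => S /eqP Sd; apply: eq_bigl => j; rewrite !inE Sd eqxx andbT.
  apply/subsetP/forall_inP => H i iS; first by have := H i iS; rewrite inE.
  by rewrite inE; apply: H.
by move=> j S _; rewrite inE => /andP[].
Qed.

Lemma not_blockE (m n d : nat) (P : 'I_m -> 'I_n -> bool) (S : {set 'I_m}) :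
  ~~ block d P -> #|S| = d -> #|common P S| < d.
Proof.
by rewrite negb_exists => /forallP/(_ S) + Sd; rewrite Sd eqxx /= ltnNge.
Qed.

Lemma sum_bin_leq (m n d : nat) (P : 'I_m -> 'I_n -> bool) : ~~ block d.+1 P ->
  \sum_j 'C(#|[set i | P i j]|, d.+1) <= 'C(m, d.+1) * d.
Proof.
move=> noP; rewrite sum_bin_common -[m in 'C(m, _)]card_ord -card_draws -sum_nat_const.
rewrite [leqRHS](eq_bigl (fun S : {set 'I_m} => #|S| == d.+1)) => [|S]; last by rewrite inE.
by apply: leq_sum => S /eqP Sd; rewrite -ltnS; apply: not_blockE.
Qed.

(** Every column contributes at least [c] to the weighted sum of the two double counts, which is too
    small if there are no blocks. *)
Lemma block_count (m n a b c : nat) (M : 'I_m -> 'I_n -> bool) :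
    (forall k, k <= m -> c <= a * 'C(m - k, 4) + b * 'C(k, 2)) ->
    a * ('C(m, 4) * 3) + b * 'C(m, 2) < c * n ->
  block 2 M || block 4 (fun i j => ~~ M i j).
Proof.
move=> weight; apply: contraTT; rewrite negb_or -leqNgt => /andP[no2 no4].
rewrite -[n]card_ord mulnC -sum_nat_const.
have := sum_bin_leq no2; rewrite muln1 => le2.
apply: leq_trans (leq_add (leq_mul (leqnn a) (sum_bin_leq no4)) (leq_mul (leqnn b) le2)).
rewrite !big_distrr -big_split /=; apply: leq_sum => j _.
have -> : [set i | ~~ M i j] = ~: [set i | M i j] by apply/setP => i; rewrite !inE.
by rewrite cardsCs setCK card_ord; apply: weight; rewrite -[leqRHS]card_ord max_card.
Qed.

(** Only the first [p] rows are searched, so one search serves every [m >= p]. Initially all columns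
    form one class, and the vector of a row is its number of red entries. *)
Lemma block_refuted (m n p : nat) (M : 'I_m -> 'I_n -> bool) :
    p <= m -> refuted p [:: n] [::] [seq [:: d] | d <- iota 0 n.+1] ->
  block 2 M || block 4 (fun i j => ~~ M i j).
Proof.
move=> pm; apply: contraTT; rewrite negb_or => /andP[no2 no4].
have countE (P : pred 'I_n) : count P (enum 'I_n) = #|[set j | P j]|.
  by rewrite cardE {2}/enum_mem -enumT size_filter; apply: eq_count => j; rewrite /= inE.
have -> : [:: n] = map size [:: enum 'I_n] by rewrite /= size_enum_ord.
apply: (@refuted_sound _ _ M (enum 'I_n) _ _ _ _ [::] (take p (enum 'I_m)) (fun=> [::])) => //.
- move=> i i' ne; rewrite countE -ltnS.
  apply: leq_ltn_trans (not_blockE (S := [set i; i']) no2 _); last by rewrite cards2 ne.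
  apply/subset_leq_card/subsetP => j; rewrite !inE => /andP[Mi Mi'].
  by apply/forall_inP => x; rewrite !inE => /orP[]/eqP ->.
- move=> s us s4; rewrite countE -ltnS.
  apply: leq_ltn_trans (not_blockE (S := [set i in s]) no4 _); last first.
    by rewrite cardsE (card_uniqP us).
  apply/subset_leq_card/subsetP => j; rewrite !inE => /allP Ms.
  by apply/forall_inP => x; rewrite inE => /Ms.
- by move=> P; rewrite /class_count /= addn0.
- by rewrite /= take_uniq ?enum_uniq.
- by rewrite size_takel // size_enum_ord.
move=> i _; apply/mapP; exists (count (M i) (enum 'I_n)) => //.
by rewrite mem_iota ltnS (leq_trans (count_size _ _)) ?size_enum_ord.
Qed.

(** * Checking explicit colourings *)

(** [cols] are the columns satisfying [P] on all rows chosen so far, [d] the number of rows left to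
    choose; a branch ends once at most [t] columns survive. *)
Fixpoint block_free (t d : nat) (P : nat -> nat -> bool) (rows cols : seq nat) : bool :=
  (size cols <= t) ||
  match d, rows with
  | 0, _ => false
  | _.+1, [::] => true
  | d'.+1, i :: rows' =>
    block_free t d' P rows' (filter (P i) cols) && block_free t d P rows' cols
  end.

Lemma block_freeP t d P rows cols s :
  block_free t d P rows cols -> subseq s rows -> size s = d ->
  count (fun j => all (P^~ j) s) cols <= t.
Proof.
elim: rows d cols s => [|i rows IH] [|d] cols s /orP[le|] //=;
  do ?by move=> *; apply: leq_trans (count_size _ _) le.
  by move=> _ /eqP ->.
case/andP=> free1 free2; case: s => //= x s; case: eqP => [-> sub [sd]|_]; last exact: IH.
apply: leq_trans (IH _ _ _ free1 sub sd).
by rewrite count_filter; apply: sub_count => j /= /andP[-> ->].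
Qed.

(** [P] is defined on all naturals so that one check also covers every smaller grid. *)
Lemma block_free_nat (m n m' n' d : nat) (P : nat -> nat -> bool) :
    block_free d d.+1 P (iota 0 m) (iota 0 n) -> m' <= m -> n' <= n ->
  ~~ block d.+1 (fun (i : 'I_m') (j : 'I_n') => P i j).
Proof.
move=> free mm nn; apply/negP => /existsP[S /andP[/eqP Sd]]; apply/negP; rewrite -ltnNge ltnS.
set s := [seq x <- iota 0 m | x \in map val (enum S)].
have sS : perm_eq s (map val (enum S)).
  apply: uniq_perm => [||x]; rewrite ?filter_uniq ?iota_uniq ?(map_inj_uniq val_inj) ?enum_uniq //.
  rewrite mem_filter mem_iota andbC; case: mapP => [[i _ ->]|]; rewrite ?andbF ?andbT //=.
  exact: leq_trans (ltn_ord i) mm.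
have sz : size s = d.+1 by rewrite (perm_size sS) size_map -cardE.
apply: leq_trans (block_freeP (s := s) free (filter_subseq _ _) sz).
rewrite -(subnKC nn) iotaD count_cat; apply: leq_trans (leq_addr _ _).
rewrite -(val_enum_ord n') count_map -size_filter cardE.
apply: uniq_leq_size; first exact: enum_uniq.
move=> j; rewrite mem_enum inE mem_filter mem_enum => /forall_inP H /=; rewrite andbT.
apply/allP => x; rewrite (perm_mem sS) => /mapP[i]; rewrite mem_enum => /H + ->.
by [].
Qed.

Lemma BR_lower (m n m' : nat) (P : nat -> nat -> bool) :
    block_free 1 2 P (iota 0 m) (iota 0 n) ->
    block_free 3 4 (fun i j => ~~ P i j) (iota 0 m) (iota 0 n) -> m' <= m ->
  forall k, BR_arrows m' (Kbip 2 2) (Kbip 4 4) k -> n < k.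
Proof.
move=> free2 free4 mm k; case: ltnP => // kn arr; exfalso; move: arr.
apply: (@not_arrowsI m' k (fun i j => P i j)); first exact: block_free_nat free2 mm kn.
exact: block_free_nat free4 mm kn.
Qed.

(** Row 0 is red, the others blue. Two rows include an all-blue one; four rows out of at most four
    include row 0. *)
Lemma no_BR m n : m <= 4 -> ~ BR_arrows m (Kbip 2 2) (Kbip 4 4) n.
Proof.
move=> m4; apply: (@not_arrowsI m n (fun i _ => i == 0 :> nat)); apply/negP => /existsP[S /andP[Sd]].
  have [i iS i0] : exists2 i, i \in S & i != 0 :> nat.
    have /cards2P[x [y [ne ->]]] := Sd.
    have [x0|x0] := eqVneq (x : nat) 0; last by exists x; rewrite // !inE eqxx.
    by exists y; rewrite ?inE ?eqxx ?orbT //; apply: contraNneq ne => y0; apply/eqP/val_inj; rewrite /= x0.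
  rewrite leqNgt => /negP; apply; rewrite ltnS (_ : common _ _ = set0) ?cards0 //.
  by apply/setP => j; rewrite !inE; apply/forall_inP => /(_ i iS); apply/negP.
have S4 : 4 <= m by rewrite -(eqP Sd) -[leqRHS]card_ord max_card.
have m0 : 0 < m by apply: leq_trans S4.
have iS : Ordinal m0 \in S.
  suff -> : S = setT by rewrite inE.
  by apply/eqP; rewrite eqEcard subsetT cardsT card_ord (eqP Sd).
rewrite leqNgt => /negP; apply; rewrite ltnS (_ : common _ _ = set0) ?cards0 //.
by apply/setP => j; rewrite !inE; apply/forall_inP => /(_ _ iS).
Qed.

(** * Extremal colourings and the theorem *)

(* Block j lists the rows joined in red to column j. *)
Definition incidence (blocks : seq (seq nat)) (i j : nat) : bool := i \in nth [::] blocks j.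

(** The edges of the complete graph on the rows: two rows share exactly one. For [m = 7], four rows
    miss just the 3 edges among the other three. *)
Definition edges (m : nat) : seq (seq nat) := [seq [:: p.1; p.2] | p <- pairs (iota 0 m)].

(** Four of the five rows miss only the three singleton columns of the fifth. *)
Definition blocks5 : seq (seq nat) :=
  edges 5 ++ flatten (nseq 3 [seq [:: i] | i <- iota 0 5]).

(* Found by computer search. *)
Definition blocks8 : seq (seq nat) :=
  [:: [:: 0; 1; 2; 3]; [:: 0; 4; 5]; [:: 0; 6]; [:: 0; 7]; [:: 1; 4; 6]; [:: 1; 5];
      [:: 1; 7]; [:: 2; 4]; [:: 2; 5; 7]; [:: 2; 6]; [:: 3; 4]; [:: 3; 5];
      [:: 3; 6; 7]; [:: 4; 7]; [:: 5; 6]].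

(* The projective plane of order 3, from the planar difference set {0, 1, 3, 9} modulo 13. *)
Definition blocks13 : seq (seq nat) :=
  [seq [seq (i + j) %% 13 | i <- [:: 0; 1; 3; 9]] | j <- iota 0 13].

Lemma refuted_8_16 : refuted 8 [:: 16] [::] [seq [:: d] | d <- iota 0 17].
Proof. by vm_compute. Qed.

Lemma refuted_9_14 : refuted 9 [:: 14] [::] [seq [:: d] | d <- iota 0 15].
Proof. by vm_compute. Qed.

Lemma is_BRI m n :
  BR_arrows m (Kbip 2 2) (Kbip 4 4) n.+1 ->
  (forall k, BR_arrows m (Kbip 2 2) (Kbip 4 4) k -> n < k) ->
  is_BR m (Kbip 2 2) (Kbip 4 4) n.+1.
Proof. by move=> up low; split=> // k _; apply: low. Qed.

Theorem theorem1 (m : nat) (hm : 2 <= m <= 13) :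
  [/\ m \in [:: 2; 3; 4] -> ~ (exists n, is_BR m (Kbip 2 2) (Kbip 4 4) n),
      m = 5 -> is_BR m (Kbip 2 2) (Kbip 4 4) 26,
      m \in [:: 6; 7] -> is_BR m (Kbip 2 2) (Kbip 4 4) 22,
      m = 8 -> is_BR m (Kbip 2 2) (Kbip 4 4) 16
    & m \in [:: 9; 10; 11; 12; 13] -> is_BR m (Kbip 2 2) (Kbip 4 4) 14].
Proof.
split=> [m4 [n [_ arr _]] | -> | m67 | -> | m13].
- by apply: no_BR arr; move: m4; rewrite !inE => /or3P[]/eqP->.
- apply: is_BRI; last by apply: (BR_lower (m := 5) (P := incidence blocks5)) => //; vm_compute.
  (* Columns with one or two red entries have the least weight, exactly [c]; the total is at most 15
     + 10 < 26. *)
  by apply: arrowsI => M; apply: (block_count (a := 1) (b := 1) (c := 1)) => //; do 6?[case=> //].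
- have m7 : m <= 7 by move: m67; rewrite !inE => /orP[]/eqP->.
  (* Deleting a row of the 7-row colouring settles 6 rows. *)
  apply: is_BRI; last by apply: (BR_lower (m := 7) (P := incidence (edges 7))) => //; vm_compute.
  apply: arrowsI => M; move: m67 M; rewrite !inE => /orP[]/eqP-> M.
    (* Weights chosen as for 5 rows: 45 + 60 < 5 * 22 here, and 105 + 210 < 15 * 22 for 7 rows. *)
    by apply: (block_count (a := 1) (b := 4) (c := 5)) => //; do 7?[case=> //].
  by apply: (block_count (a := 1) (b := 10) (c := 15)) => //; do 8?[case=> //].
- apply: is_BRI; last by apply: (BR_lower (m := 8) (P := incidence blocks8)) => //; vm_compute.
  by apply: arrowsI => M; exact: block_refuted (leqnn 8) refuted_8_16.
have {}m13 : 9 <= m <= 13 by move: m13; rewrite !inE => /or4P[/eqP->|/eqP->|/eqP->|/orP[]/eqP->].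
case/andP: m13 => m9 m13; apply: is_BRI.
  by apply: arrowsI => M; exact: block_refuted m9 refuted_9_14.
(* Two points lie on one common line, and four points miss at most three lines; deleting points
   covers 9 to 12 rows. *)
by apply: (BR_lower (m := 13) (P := incidence blocks13)) => //; vm_compute.
Qed.
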